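(* Let $G$ be a graph and let $k$, $m$ be natural numbers with $k$ odd. If $G$ is $162k^8$-good, then $G$ contains a cycle whose length is congruent to $m$ modulo $k$.
   Context: All graphs are finite and simple. A subcubic graph is a graph of maximum degree at most 3. For vertex sets or subgraphs $A,B$, an $A-B$ path is a path with one end in $A$, one end in $B$, and no internal vertex in $A\cup B$. A $\theta$-graph consists of two vertices $u,v$ and three pairwise internally disjoint $u-v$ paths, called its legs. For natural numbers $k,i$, a $\theta(k,i)$-necklace is a connected subcubic graph consisting of $k$ disjoint $\theta$-graphs $\Theta_1,\dots,\Theta_k$ and $k$ disjoint paths $P_1,\dots,P_k$ such that: $\Theta_j$ has legs $L_{j,1},L_{j,2},L_{j,3}$ where $L_{j,3}$ has length $i$ ($j=1,\dots,k$); $P_j$ is an $L_{j,2}-L_{j+1,1}$ path for $j\in\{1,\dots,k-1\}$ and $P_k$ is an $L_{k,2}-L_{1,1}$ path; and no interior vertex of any $P_j$ lies in any $\Theta_{j'}$. Two subgraphs $H_1,H_2$ of a graph are $k$-close if they are disjoint and there exist $k$ pairwise disjoint $H_1-H_2$ paths of length at most 2. Let $\mathcal{B}=\{B_1,\dots,B_\ell\}$ be a collection of pairwise disjoint 2-connected subgraphs of a graph $G$. A $\mathcal{B}$-necklace is a subgraph of $G$ consisting of $B_1,\dots,B_\ell$ and $\ell$ pairwise disjoint paths $P_1,\dots,P_\ell$ such that $P_i$ is a $B_i-B_{i+1}$ path for $i<\ell$, $P_\ell$ is a $B_\ell-B_1$ path, and no interior vertex of any $P_i$ lies in any $B_j$.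 For each $i$ let $x_i,y_i$ be the two vertices of $B_i$ contained in some path $P_j$. The necklace is $k$-wiggly if there is $I\subseteq\{1,\dots,\ell\}$ with $|I|=k$ such that for each $i\in I$, $B_i$ contains two $x_i-y_i$ paths whose lengths differ by 1 or 2. A $k$-wiggly necklace is a $k$-wiggly $\mathcal{B}$-necklace for some such $\mathcal{B}$. A graph is $k$-good if it contains as a subgraph at least one of: a $\theta(k,i)$-necklace with $i\in\{1,2\}$; a $k$-wiggly necklace; or a path and a cycle which are $k$-close. *)

(* Defs.v *)
From mathcomp Require Import all_boot.

Set Implicit Arguments.
Unset Strict Implicit.
Unset Printing Implicit Defensive.

(* A finite simple graph whose vertices form a subset of the ambient finite
   type T, so that subgraphs of a graph are again graphs over T. *)
Record graph (T : finType) := Graph {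
  vset : {set T};
  eset : {set {set T}};
  esetP : forall e, e \in eset -> (e \subset vset) && (#|e| == 2)
}.

Section Graphs.
Variable T : finType.
Implicit Types (G H B : graph T) (x y u v : T) (p q c : seq T) (A : {set T}).

Definition adj G : rel T := fun x y => [set x; y] \in eset G.

Definition subgraph H G := (vset H \subset vset G) && (eset H \subset eset G).

Lemma gdel_subproof G A e :
  e \in [set e in eset G | [disjoint e & A]] ->
  (e \subset vset G :\: A) && (#|e| == 2).
Proof.
rewrite inE => /andP[/(@esetP _ G)/andP[eV ->] eA].
by rewrite andbT subsetD eV.
Qed.

Definition gdel G A : graph T := Graph (@gdel_subproof G A).

(* Paths are given by the list of their vertices; a path with one vertex has
   length 0. *)
Definition is_path G p :=
  [&& p != [::], uniq p, all (mem (vset G)) p & sorted (adj G) p].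

Definition path_length p := (size p).-1.

Definition path_edges p : {set {set T}} :=
  [set [set a.1; a.2] | a in zip p (behead p)].

Definition interior p : {set T} :=
  if p is x :: q then [set z in p] :\: [set x; last x q] else set0.

(* p is nonempty, so the default values of head and last are irrelevant. *)
Definition xy_path G x y p :=
  [&& is_path G p, head x p == x & last y p == y].

(* The list of an A1-A2 path is read from its end in A1 to its end in A2. *)
Definition AB_path G (A1 A2 : {set T}) p :=
  exists x y, [/\ x \in A1, y \in A2, xy_path G x y p
                & [disjoint interior p & A1 :|: A2]].

Definition is_cycle G c := [&& 2 < size c, uniq c & cycle (adj G) c].

Definition connected G :=
  vset G != set0 /\
  forall x y, x \in vset G -> y \in vset G -> exists p, xy_path G x y p.

Definition two_connected G :=
  2 < #|vset G| /\ forall A, #|A| < 2 -> connected (gdel G A).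

Definition subcubic G :=
  forall x, x \in vset G -> #|[set y | adj G x y]| <= 3.

Definition theta_graph H u v p1 p2 p3 :=
  [/\ u != v,
      [/\ xy_path H u v p1, xy_path H u v p2 & xy_path H u v p3],
      pairwise (fun p q => (p != q) && [disjoint interior p & interior q])
               [:: p1; p2; p3],
      vset H = [set x in p1 ++ p2 ++ p3]
    & eset H = path_edges p1 :|: path_edges p2 :|: path_edges p3].

Section Necklaces.
Variable n : nat.

Definition disjoint_graphs (B : 'I_n -> graph T) :=
  forall i j, i != j -> [disjoint vset (B i) & vset (B j)].

Definition disjoint_paths (P : 'I_n -> seq T) :=
  forall i j, i != j -> [disjoint P i & P j].

Definition interiors_avoid (P : 'I_n -> seq T) (B : 'I_n -> graph T) :=
  forall i j, [disjoint interior (P i) & vset (B j)].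

Definition consists_of H (B : 'I_n -> graph T) (P : 'I_n -> seq T) :=
  vset H = \bigcup_i (vset (B i) :|: [set x in P i]) /\
  eset H = \bigcup_i (eset (B i) :|: path_edges (P i)).

End Necklaces.

(* ordS j is the cyclic successor of j in 'I_k. *)
Definition theta_necklace k i H :=
  [/\ connected H, subcubic H &
  exists (Theta : 'I_k -> graph T) (u v : 'I_k -> T)
         (L1 L2 L3 P : 'I_k -> seq T),
  [/\ disjoint_graphs Theta /\ disjoint_paths P,
      forall j, theta_graph (Theta j) (u j) (v j) (L1 j) (L2 j) (L3 j)
                /\ path_length (L3 j) = i,
      forall j, AB_path H [set x in L2 j] [set x in L1 (ordS j)] (P j),
      interiors_avoid P Theta
    & consists_of H Theta P]].

Definition B_necklace l (B : 'I_l -> graph T) (P : 'I_l -> seq T) H :=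
  [/\ disjoint_graphs B /\ disjoint_paths P,
      forall i, two_connected (B i),
      forall i, AB_path H (vset (B i)) (vset (B (ordS i))) (P i),
      interiors_avoid P B
    & consists_of H B P].

Definition wiggly B x y :=
  exists p q, [/\ xy_path B x y p, xy_path B x y q
    & path_length q = path_length p + 1 \/ path_length q = path_length p + 2].

Definition wiggly_necklace k H :=
  exists l (B : 'I_l -> graph T) (P : 'I_l -> seq T),
    B_necklace B P H /\
    exists I : {set 'I_l}, #|I| = k /\
      forall i, i \in I -> exists x y,
        [/\ x != y,
            [set z in vset (B i) | [exists j, z \in P j]] = [set x; y]
          & wiggly (B i) x y].

(* Whether two subgraphs of G are k-close depends only on their vertex sets. *)
Definition k_close G k (A1 A2 : {set T}) :=
  [disjoint A1 & A2] /\
  exists P : 'I_k -> seq T,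
    disjoint_paths P /\
    forall j, AB_path G A1 A2 (P j) /\ path_length (P j) <= 2.

Definition k_good k G :=
  [\/ exists H i, [/\ subgraph H G, i = 1 \/ i = 2 & theta_necklace k i H],
      exists H, subgraph H G /\ wiggly_necklace k H
    | exists p c, [/\ is_path G p, is_cycle G c
                    & k_close G k [set x in p] [set x in c]]].

End Graphs.

(* Main.v *)
Require Import Defs.
From mathcomp Require Import all_boot zify.

(* A necklace with chosen routes inside its beads closes up to a cycle whose
   length is a constant plus the sum of the route lengths. In a wiggly necklace
   [k] beads can be lengthened by the same [d], which is 1 or 2 and hence
   invertible modulo the odd number [k]. A theta bead cut at its two attachment
   points has routes of lengths [s], [s'], [u], [u'] with
   [u + u' = s + s' + 2 i], so switching [s] to [u] in one bead and [s'] to [u']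
   in a bead of the same type modulo [k] adds the invertible [2 i].

   For a path and a cycle that are close, pigeonhole and Erdos-Szekeres yield
   [2 k] links of a common length [d], whose feet on the path agree modulo [k],
   whose feet on the cycle agree modulo [k], and which meet both in the same
   order. Zigzagging along the first [2 t] links and closing up along the rest
   of the cycle gives a cycle of length [2 t d + size c] modulo [k]. *)

Set Implicit Arguments.
Unset Strict Implicit.
Unset Printing Implicit Defensive.

(** * Paths with prescribed ends *)

Section EPath.
Variables (T : finType) (e : rel T).
Implicit Types (x y z : T) (p q c : seq T).

(** Stated for an arbitrary relation, so that paths pass from a subgraph to the ambient graph by
    monotonicity. Naming the tail [q] excludes the empty list and avoids default values for the
    ends. *)
Definition epath x y p :=
  exists q, [/\ p = x :: q, path e x q, uniq (x :: q) & last x q = y].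

Lemma epath_size x y p : epath x y p -> size p = (path_length p).+1.
Proof. by case=> q [->]. Qed.

Lemma epath_uniq x y p : epath x y p -> uniq p.
Proof. by case=> q [->]. Qed.

Lemma epath_start x y p : epath x y p -> x \in p.
Proof. by case=> q [-> _ _ _]; rewrite mem_head. Qed.

Lemma epath_end x y p : epath x y p -> y \in p.
Proof. by case=> q [-> _ _ <-]; rewrite mem_last. Qed.

(** Exposes the interior [m], which is what a path contributes when its ends are already supplied by
    the pieces it joins. *)
Lemma epath_rconsE x y p : x != y -> epath x y p ->
  exists m, [/\ p = x :: rcons m y, path e x (rcons m y)
              & uniq (x :: rcons m y)].
Proof.
move=> xy [q [-> eq uq lq]]; case/lastP: q => [|m w] in eq uq lq *.
  by move: xy; rewrite -lq eqxx.
by rewrite last_rcons in lq; subst w; exists m.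
Qed.

Lemma epath_rev x y p : symmetric e -> epath x y p -> epath y x (rev p).
Proof.
move=> esym [q [-> eq uq <-]].
case: (lastP q) eq uq => [|m w] eq uq; first by exists [::].
rewrite last_rcons; exists (rcons (rev m) x).
have E : rev (x :: rcons m w) = w :: rcons (rev m) x.
  by rewrite rev_cons rev_rcons.
split; rewrite ?last_rcons //; last by rewrite -E rev_uniq.
have := rev_path e x (rcons m w); rewrite last_rcons belast_rcons rev_cons => ->.
by rewrite (eq_path (e' := e)) // => a b; apply: esym.
Qed.

Lemma path_length_rev p : path_length (rev p) = path_length p.
Proof. by rewrite /path_length size_rev. Qed.

Lemma epath_cat x y z p q : epath x y p -> epath y z q ->
  (forall w, w \in p -> w \in q -> w = y) ->
  exists r, [/\ epath x z r, path_length r = path_length p + path_length q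
              & r =i [predU p & q]].
Proof.
move=> ep [q' [-> eq uq lq]] pq.
exists (p ++ q'); move: (epath_end ep) pq => yp pq.
case: ep yp pq => p' [-> ep up lp] yp pq; split.
- exists (p' ++ q'); split=> //; last by rewrite last_cat lp.
    by rewrite cat_path ep lp.
  rewrite -cat_cons cat_uniq up; move: uq => /= /andP[yq ->]; rewrite andbT.
  apply/hasPn => w wq; apply/negP => wp; move: (pq w wp).
  by rewrite inE wq orbT => /(_ isT) E; rewrite -E wq in yq.
- by rewrite /path_length /= size_cat.
- move=> w; rewrite mem_cat [RHS]inE [w \in y :: q']inE.
  by case: eqP => [->|]; rewrite ?orbT ?yp.
Qed.

Lemma epath_split x y z p : epath x y p -> z \in p ->
  exists p1 p2, [/\ epath x z p1, epath z y p2,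
    {subset p1 <= p}, {subset p2 <= p}
    & forall w, w \in p1 -> w \in p2 -> w = z].
Proof.
case=> q [-> eq uq lq] /splitPl zq; move: zq eq uq lq.
case=> q1 q2 lz; rewrite cat_path last_cat lz -cat_cons cat_uniq.
move=> /andP[e1 e2] /and3P[u1 /hasPn d u2] lq.
have zx : z \in x :: q1 by rewrite -lz mem_last.
exists (x :: q1), (z :: q2); split.
- by exists q1.
- exists q2; split=> //=; rewrite u2 andbT; apply/negP => /d.
  by move=> /negP[].
- by move=> w w1; rewrite mem_cat w1.
- move=> w; rewrite mem_cat [w \in z :: _]inE.
  by case/predU1P=> [->|->]; rewrite ?zx ?orbT.
- by move=> w w1; rewrite inE => /predU1P[//|/d/negP[]].
Qed.

Lemma epath_segment p x y : sorted e p -> uniq p -> x \in p -> y \in p ->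
  index x p <= index y p ->
  exists q, [/\ epath x y q, path_length q = index y p - index x p
    & forall z, z \in q -> z \in p /\ index x p <= index z p <= index y p].
Proof.
move=> sp up xp yp.
move iE: (index x p) => i; move jE: (index y p) => j ij.
have jp : j < size p by rewrite -jE index_mem.
set q := take (j - i).+1 (drop i p).
have sq : size q = (j - i).+1.
  by rewrite size_takel // size_drop; lia.
have nq n : n < (j - i).+1 -> nth x q n = nth x p (i + n).
  by move=> nj; rewrite nth_take // nth_drop.
have qE : q = x :: behead q.
  have := nq 0 isT; rewrite addn0 -iE nth_index //.
  by case: (q) sq => [//|a s] _ /= <-.
exists q; split; last 1 first.
- move=> z zq; have zp : z \in p by apply: (@mem_drop i); apply: mem_take zq.
  split=> //; move/(nthP x): zq => [n]; rewrite sq => nj; rewrite nq // => <-.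
  by rewrite index_uniq //; [lia|apply: leq_ltn_trans jp; lia].
- exists (behead q); rewrite -qE; split=> //.
  + have: sorted e q by apply/take_sorted/drop_sorted.
    by rewrite {1}qE.
  + by apply/take_uniq/drop_uniq.
  + have -> : last x (behead q) = last x q by rewrite {2}qE.
    by rewrite -nth_last sq /= nq // subnKC // -jE nth_index.
- by rewrite /path_length sq.
Qed.

Lemma epath_complement c x y : cycle e c -> uniq c -> x \in c -> y \in c ->
  index x c < index y c ->
  exists q, [/\ epath y x q, path_length q + index y c = size c + index x c
    & forall z, z \in q ->
        z \in c /\ (index z c <= index x c \/ index y c <= index z c)].
Proof.
move=> + + xc; move: xc => /splitPr[c1 c2'] cc uc yc xy.
have xc1 : x \notin c1.
  by move: uc; rewrite cat_uniq /= => /and3P[_ /norP[]].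
have ix : index x (c1 ++ x :: c2') = size c1.
  by rewrite index_cat (negbTE xc1) /= eqxx addn0.
have yc2 : y \in c2'.
  move: yc xy; rewrite mem_cat inE => /or3P[y1|/eqP->|//].
    by rewrite ix index_cat y1 => h; have := index_mem y c1; rewrite y1; lia.
  by rewrite ltnn.
move: yc2 cc uc yc xy ix => /splitPr[c2 c3] cc uc yc xy ix.
have iy : index y (c1 ++ x :: c2 ++ y :: c3) = (size c1 + size c2).+1.
  have -> : c1 ++ x :: c2 ++ y :: c3 = (c1 ++ x :: c2) ++ y :: c3.
    by rewrite -catA.
  rewrite index_cat ifN /= ?eqxx ?addn0 ?size_cat //= ?addnS //.
  move: uc; have -> : c1 ++ x :: c2 ++ y :: c3 = (c1 ++ x :: c2) ++ y :: c3.
    by rewrite -catA.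
  by rewrite cat_uniq => /and3P[_ /norP[]].
set C := c1 ++ _ in cc uc yc xy ix iy *.
have cE : rot (size c1 + size c2).+1 C = y :: c3 ++ c1 ++ x :: c2.
  have -> : C = (c1 ++ x :: c2) ++ y :: c3 by rewrite -catA.
  have -> : (size c1 + size c2).+1 = size (c1 ++ x :: c2).
    by rewrite size_cat /= addnS.
  by rewrite rot_size_cat.
have := rot_uniq (size c1 + size c2).+1 C; rewrite uc cE => uc'.
have := rot_cycle (size c1 + size c2).+1 e C; rewrite cc cE => cc'.
(* The rotated cycle is the wrapping arc followed by [c2], the open arc from [x] to [y]. *)
have qE : y :: c3 ++ c1 ++ x :: c2 = (y :: c3 ++ c1 ++ [:: x]) ++ c2.
  by rewrite /= -!catA.
exists (y :: c3 ++ c1 ++ [:: x]); split.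
- exists (c3 ++ c1 ++ [:: x]); split=> //.
  + by move: cc'; rewrite qE /= rcons_path cat_path => /andP[/andP[]].
  + by move: uc'; rewrite qE cat_uniq => /and3P[].
  + by rewrite !last_cat.
- by rewrite ix iy /path_length /= !size_cat /= size_cat /=; lia.
- move=> z zq; have zc : z \in C.
    by rewrite -(mem_rot (size c1 + size c2).+1) cE qE mem_cat zq.
  split=> //; rewrite ix iy; move: zq.
  rewrite !(inE, mem_cat) => /or4P[/eqP->|z3|z1|/eqP->]; last by rewrite ix; left.
  + by rewrite iy; right.
  + right; rewrite /C -cat_cons catA index_cat ifN ?size_cat /=; first lia.
    move: uc; rewrite /C -cat_cons catA cat_uniq => /and3P[_ /hasPn h _].
    by apply: h; rewrite inE z3 orbT.
  + by left; rewrite /C index_cat z1; have := index_mem z c1; rewrite z1; lia.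
Qed.

(** The list consists of [p] and the interior of [q]. An edge and its reversal give size 2, so a use
    for genuine cycles has to bound the size separately. *)
Lemma epath_cycle x y p q : x != y -> epath x y p -> epath y x q ->
  (forall w, w \in p -> w \in q -> w = x \/ w = y) ->
  exists c, [/\ cycle e c, uniq c & size c = path_length p + path_length q].
Proof.
move=> xy [p' [-> ep up lp]] eq pq; rewrite eq_sym in xy.
have [m [E em um]] := epath_rconsE xy eq; rewrite E in pq *.
exists (x :: p' ++ m); split.
- by rewrite /= rcons_cat cat_path ep lp.
- rewrite -cat_cons cat_uniq up; move: um => /=.
  rewrite mem_rcons inE rcons_uniq => /and3P[/norP[_ ym] xm ->]; rewrite andbT.
  apply/hasPn => w wm; apply/negP => /pq; rewrite inE mem_rcons inE wm !orbT.
  by case=> // E'; rewrite E' ?(negbTE ym) ?(negbTE xm) in wm.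
- by rewrite /path_length /= size_cat size_rcons addnS; lia.
Qed.

Lemma epath_edge x y p : x != y -> epath x y p ->
  exists w, [/\ e x w, w \in p & w != x].
Proof.
move=> xy [[|w q] [-> ep up lp]]; first by rewrite -lp eqxx in xy.
exists w; move: ep up => /= /andP[-> _] /andP[+ _].
rewrite !inE eqxx orbT => /norP[+ _].
by rewrite eq_sym.
Qed.

Lemma mem_interior x y p z : epath x y p ->
  (z \in interior p) = [&& z \in p, z != x & z != y].
Proof.
case=> q [-> _ _ lq]; rewrite /interior !inE lq.
by rewrite negb_or andbC.
Qed.

End EPath.

Lemma epath_sub (T : finType) (e e' : rel T) x y p :
  subrel e e' -> epath e x y p -> epath e' x y p.
Proof. by move=> s [q [-> ep up lp]]; exists q; split=> //; apply: sub_path ep. Qed.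

(** * Paths in a graph as paths of its adjacency relation *)

Section Adj.
Variable T : finType.
Implicit Types (G H : graph T) (p : seq T).

Lemma adj_sym G : symmetric (adj G).
Proof. by move=> x y; rewrite /adj setUC. Qed.

Lemma adj_vset G x y : adj G x y -> x \in vset G.
Proof.
by move=> /esetP/andP[/subsetP xyV _]; apply: xyV; rewrite !inE eqxx.
Qed.

Lemma xy_path_epath G x y p : xy_path G x y p ->
  epath (adj G) x y p /\ {subset p <= vset G}.
Proof.
case/and3P=> /and4P[]; case: p => [//|z p] _ up /allP aV sp /eqP /= zx /eqP lp.
subst z; split; [by exists p; split | by move=> w /aV].
Qed.

Lemma adj_sub H G : eset H \subset eset G -> subrel (adj H) (adj G).
Proof. by move=> /subsetP s x y; apply: s. Qed.

End Adj.

(** * Cycles along necklaces, and arithmetic *)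

(** Under [val] the enumeration becomes an [iota], along which the successor never wraps; only the
    closing step does. *)
Lemma fcycle_ordS n : fcycle (@ordS n) (enum 'I_n).
Proof.
case: n => [|n]; first by rewrite enum_ord0.
pose r : rel nat := fun a b => a.+1 %% n.+1 == b.
have -> : fcycle (@ordS n.+1) (enum 'I_n.+1) = cycle r (map val (enum 'I_n.+1)).
  by rewrite cycle_map; apply: eq_cycle => i j.
rewrite val_enum_ord /= rcons_path; apply/andP; split.
  have h m a : a + m <= n -> path r a (iota a.+1 m).
    elim: m a => [//|m IH] a am /=; rewrite IH ?andbT; last lia.
    by rewrite /r modn_small //; lia.
  by apply: h.
have -> : last 0 (iota 1 n) = n.
  by rewrite -nth_last size_iota; case: n {r} => // n; rewrite nth_iota.
by rewrite /r modnn.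
Qed.

Lemma ordS_neq n (i : 'I_n) : 1 < n -> ordS i != i.
Proof.
move=> n1; apply/eqP => /(congr1 val) /=; have := ltn_ord i.
have [in'|] := ltnP i.+1 n; first by rewrite modn_small //; lia.
by move=> h1 h2; have -> : i.+1 = n; [lia | rewrite modnn; lia].
Qed.

Section CycleFromSegments.
Variables (T : finType) (e : rel T) (I : eqType) (x : I -> T) (s : I -> seq T).
Hypothesis sP : forall i, path e (x i) (s i).

Let S i := x i :: s i.
Let r : rel I := fun i j => e (last (x i) (s i)) (x j).

(** A walk on indices expands to a walk on vertices: [sP] supplies the edges inside the segments and
    [r] those between consecutive segments. *)
Lemma path_flatten i l : path r i l ->
  path e (last (x i) (s i)) (flatten (map S l)).
Proof.
elim: l i => [//|j l IH] i /= /andP[rij /IH jl].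
by rewrite cat_path sP jl !andbT.
Qed.

Lemma cycle_flatten l : cycle r l -> cycle e (flatten (map S l)).
Proof.
case: l => [//|i l] /path_flatten /=; rewrite rcons_cat cat_path sP /=.
by rewrite map_rcons flatten_rcons cat_path rcons_path /= => /and3P[-> ->].
Qed.

End CycleFromSegments.

Lemma uniq_flatten_map (I T : eqType) (S : I -> seq T) (l : seq I) :
  uniq l -> (forall i, uniq (S i)) ->
  (forall i j z, i != j -> z \in S i -> z \notin S j) ->
  uniq (flatten (map S l)).
Proof.
move=> ul uS dS; elim: l ul => [//|i l IH] /= /andP[il /IH ul].
rewrite cat_uniq uS ul andbT; apply/hasPn => z /flattenP[_ /mapP[j jl ->] zj].
by apply: dS zj; apply: contraNneq il => <-.
Qed.

(** Segment [i] is the route [Q i] followed by the interior of the link [P i], whose ends already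
    lie on [Q i] and [Q (ordS i)]. Dropping these two ends leaves
    [path_length (P i) + path_length (Q i)] vertices. *)
Lemma necklace_cycle (T : finType) (e : rel T) n (x y : 'I_n -> T)
    (P Q : 'I_n -> seq T) :
  (forall i, epath e (x i) (y i) (Q i)) ->
  (forall i, epath e (y i) (x (ordS i)) (P i)) ->
  (forall i, y i != x (ordS i)) ->
  (forall i j z, i != j -> z \in Q i -> z \notin Q j) ->
  (forall i j z, i != j -> z \in P i -> z \notin P j) ->
  (forall i j z, z \in P i -> z \in Q j -> z = y i \/ z = x (ordS i)) ->
  exists c, [/\ cycle e c, uniq c
    & size c = \sum_(i < n) path_length (P i)
               + \sum_(i < n) path_length (Q i)].
Proof.
move=> eQ eP yx dQ dP dPQ.
have [q qP] := fin_all_exists eQ.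
have [m mP] := fin_all_exists (fun i => epath_rconsE (yx i) (eP i)).
pose s i := q i ++ m i.
have SE i : x i :: s i = Q i ++ m i by have [-> _ _ _] := qP i.
have mQ i j z : z \in m i -> z \notin Q j.
  move=> zm; have [PE _] := mP i; rewrite /= mem_rcons inE rcons_uniq.
  case/and3P=> /norP[_ ym] xm _; apply/negP => /(dPQ i j z).
  rewrite PE inE mem_rcons inE zm !orbT.
  by case=> // E; rewrite E ?(negbTE ym) ?(negbTE xm) in zm.
exists (flatten (map (fun i => x i :: s i) (enum 'I_n))); split.
- apply: cycle_flatten.
    move=> i; have [_ pq _ lq] := qP i; have [_ pm _] := mP i.
    by rewrite cat_path pq lq; move: pm; rewrite rcons_path => /andP[].
  apply: sub_cycle (fcycle_ordS n) => i _ /eqP <-.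
  have [_ _ _ lq] := qP i; have [_ + _] := mP i.
  by rewrite rcons_path last_cat lq => /andP[].
- apply: uniq_flatten_map (enum_uniq _) _ _ => i => [|j z ij]; rewrite !SE.
    rewrite cat_uniq (epath_uniq (eQ i)); have [_ _ /=] := mP i.
    rewrite rcons_uniq => /and3P[_ _ ->]; rewrite andbT.
    by apply/hasPn => z; apply: mQ.
  rewrite !mem_cat => /orP[zi|zi]; apply/norP; split.
  + exact: dQ zi.
  + by apply/negP => zj; move: (mQ j i z zj); rewrite zi.
  + exact: mQ zi.
  + have zP : z \in P i by have [-> _ _] := mP i; rewrite inE mem_rcons inE zi !orbT.
    apply: contra (dP i j z ij zP) => zj.
    by have [-> _ _] := mP j; rewrite inE mem_rcons inE zj !orbT.
- rewrite size_flatten /shape -map_comp sumnE big_map big_enum -big_split /=.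
  apply: eq_bigr => i _; rewrite -[(size (s i)).+1]/(size (x i :: s i)) SE.
  have [-> _ _] := mP i; rewrite size_cat (epath_size (eQ i)).
  by rewrite /path_length /= size_rcons; lia.
Qed.

(** * Pigeonhole and linear congruences *)

Lemma pigeonhole (X Y : finType) (f : X -> Y) (A : {set X}) r :
  0 < #|Y| -> #|Y| * r <= #|A| -> exists y, r <= #|[set x in A | f x == y]|.
Proof.
move=> Y0 rA; case: (boolP [exists y, r <= #|[set x in A | f x == y]|]).
  by case/existsP=> y ry; exists y.
move=> /existsPn h; exfalso; move: rA; apply/negP; rewrite -ltnNge.
rewrite -sum1_card (partition_big f predT) //=.
have /card_gt0P[y0 _] := Y0.
have h' y : \sum_(i in A | f i == y) 1 < r.
  by have := h y; rewrite -ltnNge -sum1_card; under eq_bigl do rewrite inE.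
rewrite -sum_nat_const (bigD1 y0) //= [ltnRHS](bigD1 y0) //=.
rewrite -addSn leq_add //; apply: leq_sum => y _; exact: ltnW.
Qed.

Lemma linear_residue k d c m : 0 < k -> coprime d k ->
  exists2 t, t < k & c + t * d = m %[mod k].
Proof.
(* Bezout needs [d] positive; if [d] is 0, coprimality forces [k = 1]. *)
move=> k0 dk; have [d0|d0] := posnP d.
  move: dk; rewrite d0 /coprime gcd0n => /eqP ->.
  by exists 0 => //; rewrite !modn1.
have [[u v] /= uv] := coprimeP k d0 dk.
(* [u] inverts [d] modulo [k], and [c * k.-1] stands for the negative of [c]. *)
exists ((u * (m + c * k.-1)) %% k); first by rewrite ltn_mod.
rewrite -modnDmr modnMml modnDmr mulnAC.
have -> : u * d = v * k + 1 by lia.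
rewrite mulnDl mul1n.
have -> : c + (v * k * (m + c * k.-1) + (m + c * k.-1)) =
  (v * (m + c * k.-1) + c) * k + m by case: k k0 {dk uv} => // k _ /=; lia.
by rewrite modnMDl.
Qed.

(** * Reaching every residue by switching routes *)

Section SwitchArithmetic.
Variables (n k c0 m : nat) (avail : 'I_n -> nat -> Prop).
Hypothesis k_odd : odd k.
Hypothesis avail_mod : forall i d d', d = d' %[mod k] -> avail i d -> avail i d'.

Let k_gt0 : 0 < k. Proof. by case: k k_odd. Qed.

Lemma sum_switch (J : seq 'I_n) a : uniq J ->
  \sum_(i < n) (i \in J) * a = size J * a.
Proof.
move=> uJ; rewrite -big_distrl /=; congr (_ * _).
by rewrite -(card_uniqP uJ) -sum1_card [RHS]big_mkcond.
Qed.

Lemma uniq_take_card (A : {set 'I_n}) r : r <= #|A| ->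
  [/\ uniq (take r (enum A)), size (take r (enum A)) = r
    & {subset take r (enum A) <= A}].
Proof.
move=> rA; split; first by apply/take_uniq/enum_uniq.
  by rewrite size_takel // -cardE.
by move=> i /mem_take; rewrite mem_enum.
Qed.

(** Think of [avail i d] as: bead [i] has a route of length [d] modulo [k]. By pigeonhole at least
    [k] indices of [I] share the same gain, 1 or 2, which is coprime to the odd [k]; using it at
    fewer than [k] of them reaches any residue. *)
Lemma wiggly_residues (s : 'I_n -> nat) (I : {set 'I_n}) :
  (forall i, avail i (s i)) -> 2 * k <= #|I| ->
  (forall i, i \in I -> avail i (s i + 1) \/ avail i (s i + 2)) ->
  exists2 d, forall i, avail i (d i) & c0 + \sum_(i < n) d i = m %[mod k].
Proof.
move=> sP kI wP.
have [b bP] : exists b : 'I_n -> bool, forall i, i \in I -> avail i (s i + (b i).+1).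
  have h i : exists b : bool, i \in I -> avail i (s i + b.+1).
    have [/wP[]|_] := boolP (i \in I); [exists false|exists true|exists true] => //.
  exact: (fin_all_exists h).
have kI' : #|{: bool}| * k <= #|I| by rewrite card_bool.
have [|a ka] := pigeonhole b _ kI'; first by rewrite card_bool.
have [uJ sJ JI] := uniq_take_card ka; set J := take _ _ in uJ sJ JI.
(* [a] is a boolean, so the gain [a.+1] is 1 or 2. *)
have ak : coprime a.+1 k by case: (a); rewrite ?coprime2n ?coprime1n.
have [t tk tE] := linear_residue (c0 + \sum_(i < n) s i) m k_gt0 ak.
exists (fun i => s i + (i \in take t J) * a.+1).
  move=> i; case: (boolP (i \in _)) => [/mem_take/JI|]; last by rewrite addn0.
  by rewrite inE mul1n => /andP[/bP + /eqP <-].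
rewrite big_split /= sum_switch; last exact: take_uniq.
rewrite size_takel ?sJ 1?ltnW //.
by rewrite addnA.
Qed.

(* By pigeonhole [a := u i - s i] modulo [k] is constant on [2 k] of the
   indices; then [u' i - s' i = 2 h - a] there, and making both switches [t]
   times each adds [2 h t]. *)
Lemma theta_residues (s s' u u' : 'I_n -> nat) h : coprime (2 * h) k ->
  (forall i, [/\ avail i (s i), avail i (s' i), avail i (u i) & avail i (u' i)]) ->
  (forall i, s i + s' i + 2 * h = u i + u' i) ->
  k * (2 * k) <= n ->
  exists2 d, forall i, avail i (d i) & c0 + \sum_(i < n) d i = m %[mod k].
Proof.
move=> hk aP sP kn.
have kE x : k.-1 * x + x = x * k by rewrite -mulSnr prednK // mulnC.
(* The color of [i] is [u i - s i] modulo [k]. *)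
pose f i : 'I_k := Ordinal (ltn_pmod (u i + s i * k.-1) k_gt0).
have kT : #|'I_k| * (2 * k) <= #|[set: 'I_n]| by rewrite cardsT !card_ord.
have [|a ka] := pigeonhole f _ kT; first by rewrite card_ord.
have [uJ sJ JI] := uniq_take_card ka; set J := take _ _ in uJ sJ JI.
have suE i : i \in J -> s i + a = u i %[mod k].
  move/JI; rewrite inE => /andP[_ /eqP <-] /=.
  rewrite modnDmr; have -> : s i + (u i + s i * k.-1) = s i * k + u i.
    by have := kE (s i); lia.
  by rewrite modnMDl.
(* [b] is [2 * h - a] modulo [k], the gain of switching from [s' i] to [u' i]. *)
pose b := 2 * h + k.-1 * a.
have suE' i : i \in J -> s' i + b = u' i %[mod k].
  move=> /suE E; apply/eqP; rewrite -(eqn_modDl (u i)) -(eqn_modDr k).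
  have -> : u i + u' i + k = s i + s' i + 2 * h + k by rewrite sP.
  rewrite eqn_modDr -modnDml -E modnDml /b.
  have -> : s i + a + (s' i + (2 * h + k.-1 * a)) = a * k + (s i + s' i + 2 * h).
    by have := kE a; lia.
  by rewrite modnMDl.
pose J1 := take k J; pose J2 := drop k J.
have [uJ1 uJ2] : uniq J1 /\ uniq J2 by rewrite take_uniq ?drop_uniq.
have [sJ1 sJ2] : size J1 = k /\ size J2 = k.
  by rewrite size_takel ?size_drop sJ; lia.
have J12 i : i \in J1 -> i \notin J2.
  move: uJ; rewrite -(cat_take_drop k J) cat_uniq => /and3P[_ /hasPn h' _] i1.
  by apply/negP => /h'/negP[].
(* Switching to [u] on [J1] adds [a]; starting from [s'] on [J2] makes a switch to [u'] there add
   [b]. *)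
pose base i := if i \in J2 then s' i else s i.
have [t tk tE] := linear_residue (c0 + \sum_(i < n) base i) m k_gt0 hk.
exists (fun i => base i + (i \in take t J1) * a + (i \in take t J2) * b).
  move=> i; have [si s'i ui u'i] := aP i; rewrite /base.
  have [i1|i1] := boolP (i \in take t J1).
    have i2 := J12 i (mem_take i1); rewrite (negbTE i2).
    rewrite (negbTE (contra (@mem_take _ _ _ i) i2)) addn0 mul1n.
    by apply: avail_mod ui; rewrite suE //; apply: mem_take (mem_take i1).
  rewrite mul0n addn0.
  have [i2|i2] := boolP (i \in take t J2); last by rewrite addn0; case: ifP.
  rewrite (mem_take i2) mul1n.
  by apply: avail_mod u'i; rewrite suE' //; apply: mem_drop (mem_take i2).
rewrite !big_split /= !sum_switch; [|exact: take_uniq..].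
have [t1 t2] : t <= size J1 /\ t <= size J2 by rewrite sJ1 sJ2 ltnW.
rewrite (size_takel t1) (size_takel t2).
rewrite -tE !addnA.
have -> : c0 + \sum_(i < n) base i + t * a + t * b =
  t * a * k + (c0 + \sum_(i < n) base i + t * (2 * h)).
  by rewrite /b -mulnA -kE; lia.
by rewrite modnMDl.
Qed.

End SwitchArithmetic.

(* Erdos-Szekeres, by repeatedly peeling off the minimal elements. *)
Lemma chain_or_antichain (X : finType) (R : rel X) q r (J : {set X}) :
  irreflexive R -> transitive R -> q * r <= #|J| ->
  (exists A : {set X}, [/\ A \subset J, q <= #|A|
      & {in A &, forall i j, ~~ R i j}]) \/
  (exists s, [/\ size s = r, {subset s <= J} & sorted R s]).
Proof.
move=> irrR trR; elim: r J => [|r IH] J qr; first by right; exists [::].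
(* The minimal elements form an antichain; if there are fewer than [q] of them, at least [q * r]
   elements remain. *)
pose M := [set j in J | [forall i in J, ~~ R i j]].
have MJ : M \subset J by apply/subsetP => j; rewrite inE => /andP[].
have [qM|qM] := leqP q #|M|.
  left; exists M; split=> // i j iM; rewrite inE => /andP[_ /forall_inP]; apply.
  exact: (subsetP MJ).
have cJ : #|J :\: M| = #|J| - #|M| by rewrite cardsD (setIidPr MJ).
have JMJ j : j \in J :\: M -> j \in J by rewrite inE => /andP[].
case: (IH (J :\: M)); first by rewrite cJ; nia.
  by case=> A [AJ qA aA]; left; exists A; rewrite (subset_trans AJ) ?subsetDl.
(* An empty chain means [r = 0], and any remaining element is a chain of size 1. Otherwise the head
   [j] is not minimal in [J], so some [i] below it can be put in front. *)
case=> [[|j s]] [sr sJ sR]; right.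
  have /card_gt0P[j jJ] : 0 < #|J :\: M| by rewrite cJ; nia.
  by exists [:: j]; rewrite -sr; split=> // i; rewrite inE => /eqP->; apply: JMJ.
have := sJ j (mem_head _ _); rewrite !inE => /andP[+ jJ]; rewrite jJ /=.
rewrite negb_forall_in => /exists_inP[i iJ]; rewrite negbK => Rij.
exists (i :: j :: s); rewrite /= Rij -sr; split=> // l.
by rewrite inE => /predU1P[->//|/sJ/JMJ].
Qed.

(** For the strict product order [R], a chain increases in both coordinates, while an antichain
    sorted by [a] decreases in [b]. Injectivity makes both comparisons strict. *)
Lemma monotone_sequence (X : finType) (a b : X -> nat) (J : {set X}) r :
  {in J &, injective a} -> {in J &, injective b} -> r * r <= #|J| ->
  exists s, [/\ size s = r, {subset s <= J}, sorted (relpre a ltn) s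
              & sorted (relpre b ltn) s \/ sorted (relpre b gtn) s].
Proof.
move=> ia ib rJ; pose R : rel X := fun i j => (a i < a j) && (b i < b j).
have irrR : irreflexive R by move=> i; rewrite /R ltnn.
have trR : transitive R.
  by move=> j i l /andP[h1 h2] /andP[h3 h4]; rewrite /R; lia.
have [[A [/subsetP AJ rA aA]]|[s [sr sJ sR]]] := chain_or_antichain irrR trR rJ.
  pose s := take r (sort (relpre a leq) (enum A)).
  have sA i : i \in s -> i \in A by move/mem_take; rewrite mem_sort mem_enum.
  have sle : sorted (relpre a leq) s.
    apply/take_sorted/sort_sorted => i j; exact: leq_total.
  have us : uniq s by rewrite take_uniq // sort_uniq enum_uniq.
  have slt : sorted (relpre a ltn) s.
    move: (sle) (us); rewrite -!sorted_map.
    have uas : uniq (map a s) = uniq s.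
      apply: map_inj_in_uniq => i j /sA/AJ iJ /sA/AJ jJ; exact: ia.
    by rewrite -uas ltn_sorted_uniq_leq => -> ->.
  exists s; split=> //.
  + by rewrite size_takel // size_sort -cardE.
  + by move=> i /sA/AJ.
  + right; apply: (@sub_in_sorted _ (mem A) (relpre a ltn)) slt; last first.
      by apply/allP => i /sA.
    move=> i j iA jA /= aij; have := aA i j iA jA; rewrite /R aij /=.
    case: ltngtP => // E; by rewrite (ib i j (AJ _ iA) (AJ _ jA) E) ltnn in aij.
exists s; split=> //.
- by apply: sub_sorted sR => i j /andP[].
- by left; apply: sub_sorted sR => i j /andP[].
Qed.

(** * Wiggly and theta necklaces *)

Section NecklaceCycles.
Variables (T : finType) (G : graph T) (n k : nat).
Variables (V : 'I_n -> {set T}) (P : 'I_n -> seq T) (xs ys : 'I_n -> T).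
Hypothesis n_gt2 : 2 < n.
Hypothesis V_disj : forall i j, i != j -> [disjoint V i & V j].
Hypothesis P_disj : disjoint_paths P.
Hypothesis P_path : forall i, epath (adj G) (ys i) (xs i) (P i).
Hypothesis ysV : forall i, ys i \in V i.
Hypothesis xsV : forall i, xs i \in V (ordS i).
Hypothesis P_int : forall i j, [disjoint interior (P i) & V j].

(** Both [xs] and [ys] are indexed by links: [P i] leaves bead [i] at [ys i] and enters the next
    bead at [xs i], so bead [i] itself is entered at [xs (ord_pred i)]. *)
Definition route i d := exists q,
  [/\ epath (adj G) (xs (ord_pred i)) (ys i) q, {subset q <= V i}
    & path_length q = d %[mod k]].

Lemma route_mod i d d' : d = d' %[mod k] -> route i d -> route i d'.
Proof. by move=> dd' [q [eq qV qd]]; exists q; rewrite qd. Qed.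

Lemma ys_neq_xs i : ys i != xs i.
Proof.
apply: contraTneq (ysV i) => ->; have := xsV i.
have /V_disj/disjointFr : ordS i != i by apply: ordS_neq; apply: ltnW.
by move=> h /h ->.
Qed.

(** The entry and the exit of a bead lie on two different links, which are disjoint. *)
Lemma xs_pred_neq_ys i : xs (ord_pred i) != ys i.
Proof.
apply/eqP => E; have /P_disj/disjointFr : ord_pred i != i.
  apply: contraTneq (ordS_neq i (ltnW n_gt2)) => E'.
  by rewrite -{1}E' ord_predK eqxx.
move=> /(_ _ (epath_end (P_path _))); rewrite E.
by rewrite (epath_start (P_path i)).
Qed.

Lemma route_cycle (d : 'I_n -> nat) : (forall i, route i (d i)) ->
  exists c, is_cycle G c /\
    size c = \sum_(i < n) path_length (P i) + \sum_(i < n) d i %[mod k].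
Proof.
move=> /fin_all_exists[Q QP].
have xE i : xs (ord_pred (ordS i)) = xs i by rewrite ordSK.
have [| | | | | |c [cc uc sc]] :=
  @necklace_cycle _ (adj G) n (xs \o @ord_pred n) ys P Q.
- by move=> i; have [] := QP i.
- by move=> i /=; rewrite xE.
- by move=> i /=; rewrite xE ys_neq_xs.
- move=> i j z ij; have [_ QVi _] := QP i; have [_ QVj _] := QP j.
  move=> /QVi zi; apply/negP => /QVj.
  by rewrite (disjointFr (V_disj ij) zi).
- by move=> i j z ij zi; rewrite (disjointFr (P_disj ij) zi).
- move=> i j z zP zQ /=; rewrite xE; have [_ /(_ z zQ) zV _] := QP j.
  have := disjointFl (P_int i j) zV; rewrite (mem_interior _ (P_path i)) zP /=.
  by move=> /negbT; rewrite negb_and !negbK => /orP[]/eqP; [left|right].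
exists c; split; last first.
  rewrite sc -[LHS]modnDmr -[RHS]modnDmr; congr ((_ + _) %% _).
  rewrite -[LHS]modn_summ -[RHS]modn_summ; congr (_ %% _).
  by apply: eq_bigr => i _; have [] := QP i.
apply/and3P; split=> //; rewrite sc.
(* Each link joins different beads and has length at least 1, so more than two links give more than
   two vertices. *)
apply: leq_trans n_gt2 (leq_trans _ (leq_addr _ _)).
rewrite -[leqLHS]card_ord -sum1_card leq_sum // => i _.
have [m [-> _ _]] := epath_rconsE (ys_neq_xs i) (P_path i).
by rewrite /path_length /= size_rcons.
Qed.

End NecklaceCycles.

Lemma AB_path_ends (T : finType) (H : graph T) n (A A' : 'I_n -> {set T}) P :
  (forall i, AB_path H (A i) (A' i) (P i)) ->
  exists xs ys : 'I_n -> T, forall i,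
    [/\ xs i \in A' i, ys i \in A i & epath (adj H) (ys i) (xs i) (P i)].
Proof.
move=> /fin_all_exists[ys /fin_all_exists[xs h]]; exists xs, ys => i.
by have [? ? /xy_path_epath[] ] := h i.
Qed.

Lemma consists_of_sub (T : finType) (H : graph T) n (B : 'I_n -> graph T) P i :
  consists_of H B P -> eset (B i) \subset eset H.
Proof.
by case=> _ ->; apply: subset_trans (bigcup_sup i _) => //; apply: subsetUl.
Qed.

Lemma wiggly_necklace_residue (T : finType) (G H : graph T) k m N :
  odd k -> 2 < N -> 2 * k <= N -> subgraph H G -> wiggly_necklace N H ->
  exists c, is_cycle G c /\ size c = m %[mod k].
Proof.
move=> k_odd N2 kN /andP[_ /adj_sub HG].
case=> n [B [P [[[dB dP] tB AB iP cH] [I [cI wI]]]]].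
have n2 : 2 < n.
  by apply: leq_trans N2 _; rewrite -cI -[n in _ <= n]card_ord max_card.
have [xs [ys eP]] := AB_path_ends AB.
have PG i : epath (adj G) (ys i) (xs i) (P i).
  by have [_ _ /(epath_sub HG)] := eP i.
have BG i : subrel (adj (B i)) (adj G).
  by move=> x y /(adj_sub (consists_of_sub i cH))/HG.
have ysV i : ys i \in vset (B i) by have [] := eP i.
have xsV i : xs i \in vset (B (ordS i)) by have [] := eP i.
have xsV' i : xs (ord_pred i) \in vset (B i) by rewrite -{2}(ord_predK i).
have xy i := xs_pred_neq_ys n2 dP PG i.
(* Wiggliness names the attachment vertices as an unordered pair, so the path may have to be
   reversed. *)
have avail_of i x y p : xy_path (B i) x y p ->
    [set xs (ord_pred i); ys i] = [set x; y] ->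
    route G k (fun i => vset (B i)) xs ys i (path_length p).
  move=> /xy_path_epath[/(epath_sub (BG i)) ep pV] E.
  have : (xs (ord_pred i) \in [set x; y]) && (ys i \in [set x; y]).
    by rewrite -E !inE !eqxx orbT.
  have xyi := xy i; rewrite !inE => /andP[/pred2P[] Ex /pred2P[] Ey];
    rewrite ?Ex ?Ey ?eqxx // in xyi *.
    by exists p; rewrite Ex Ey.
  exists (rev p); rewrite Ex Ey path_length_rev; split=> //.
    exact: epath_rev (@adj_sym _ G) ep.
  by move=> z; rewrite mem_rev; apply: pV.
have attach i : [set xs (ord_pred i); ys i] \subset
    [set z in vset (B i) | [exists j, z \in P j]].
  apply/subsetP => z; rewrite !inE => /pred2P[]->.
    rewrite xsV'; apply/existsP; exists (ord_pred i); exact: epath_end (PG _).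
  rewrite ysV; apply/existsP; exists i; exact: epath_start (PG _).
have /fin_all_exists[s sP] i : exists s,
    route G k (fun i => vset (B i)) xs ys i s /\
    (i \in I -> route G k (fun i => vset (B i)) xs ys i (s + 1) \/
                route G k (fun i => vset (B i)) xs ys i (s + 2)).
  have [/wI[x [y [xy' E [p [q [ep eq pq]]]]]]|_] := boolP (i \in I).
    have E' : [set xs (ord_pred i); ys i] = [set x; y].
      by apply/eqP; rewrite eqEcard !cards2 xy xy' andbT -E attach.
    exists (path_length p); split; first exact: avail_of ep E'.
    move=> _; have := avail_of _ _ _ _ eq E'.
    by case: pq => ->; [left|right].
  (* Outside [I] any route will do; deleting the empty set from a 2-connected bead shows that it is
     connected. *)
  have [_ /(_ set0)] := tB i; rewrite cards0 => /(_ isT)[_].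
  move=> /(_ (xs (ord_pred i)) (ys i)); rewrite !inE xsV' ysV.
  case=> // p /xy_path_epath[ep pV]; exists (path_length p); split=> //.
  exists p; split=> //; last by move=> z /pV; rewrite inE => /andP[].
  apply: epath_sub ep => a b; rewrite /adj inE => /andP[+ _].
  exact: BG.
have kI : 2 * k <= #|I| by rewrite cI.
have [|d dP' dE] := wiggly_residues (\sum_(i < n) path_length (P i)) m k_odd
  _ kI (fun i => proj2 (sP i)).
  by move=> i; have [] := sP i.
have [c [cc sc]] := route_cycle n2 dB dP PG ysV xsV iP dP'.
by exists c; rewrite sc.
Qed.

(* The legs are cut at [x] and [y]; the four routes use the two pieces at [u],
   the two pieces at [v], or one piece at each end joined by the third leg. *)
Lemma theta_routes (T : finType) (e : rel T) u v x y p1 p2 p3 :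
  symmetric e -> epath e u v p1 -> epath e u v p2 -> epath e u v p3 ->
  (forall z, z \in p1 -> z \in p2 -> z = u \/ z = v) ->
  (forall z, z \in p1 -> z \in p3 -> z = u \/ z = v) ->
  (forall z, z \in p2 -> z \in p3 -> z = u \/ z = v) ->
  x \in p1 -> x != u -> x != v -> y \in p2 -> y != u -> y != v ->
  exists q1 q2 q3 q4,
    [/\ [/\ epath e x y q1, epath e x y q2, epath e x y q3 & epath e x y q4],
        {subset q1 ++ q2 ++ q3 ++ q4 <= p1 ++ p2 ++ p3}
      & path_length q1 + path_length q2 + 2 * path_length p3
        = path_length q3 + path_length q4].
Proof.
move=> esym e1 e2 e3 d12 d13 d23 x1 xu xv y2 yu yv.
(* [A] and [B] are the pieces at [u], [A'] and [B'] those at [v]. As [A] meets [A'] only in [x], it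
   misses [v]; likewise for the other pieces. *)
have [A [A' [eA eA' sA sA' dA]]] := epath_split e1 x1.
have [B [B' [eB eB' sB sB' dB]]] := epath_split e2 y2.
have Av z : z \in A -> z != v.
  move=> zA; apply: contraNneq xv => E; rewrite eq_sym; apply/eqP.
  by apply: dA; rewrite -?E // E; apply: epath_end eA'.
have Au z : z \in A' -> z != u.
  move=> zA; apply: contraNneq xu => E; rewrite eq_sym; apply/eqP.
  by apply: dA; rewrite -?E // E; apply: epath_start eA.
have Bv z : z \in B -> z != v.
  move=> zA; apply: contraNneq yv => E; rewrite eq_sym; apply/eqP.
  by apply: dB; rewrite -?E // E; apply: epath_end eB'.
have Bu z : z \in B' -> z != u.
  move=> zA; apply: contraNneq yu => E; rewrite eq_sym; apply/eqP.
  by apply: dB; rewrite -?E // E; apply: epath_start eB.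
have {}eA := epath_rev esym eA; have {}eB' := epath_rev esym eB'.
have e3' := epath_rev esym e3.
have [|q1 [eq1 l1 m1]] := epath_cat eA eB.
  move=> z; rewrite mem_rev => zA zB.
  have [//|E] := d12 z (sA z zA) (sB z zB).
  by move: (Av z zA); rewrite E eqxx.
have [|q2 [eq2 l2 m2]] := epath_cat eA' eB'.
  move=> z; rewrite mem_rev => zA zB.
  have [E|//] := d12 z (sA' z zA) (sB' z zB).
  by move: (Au z zA); rewrite E eqxx.
have [|r3 [er3 l3 m3]] := epath_cat e3 eB'.
  move=> z; rewrite mem_rev => z3 zB.
  have [E|//] := d23 z (sB' z zB) z3.
  by move: (Bu z zB); rewrite E eqxx.
have [|r4 [er4 l4 m4]] := epath_cat e3' eB.
  move=> z; rewrite mem_rev => z3 zB.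
  have [//|E] := d23 z (sB z zB) z3.
  by move: (Bv z zB); rewrite E eqxx.
have [|q3 [eq3 l3' m3']] := epath_cat eA er3.
  move=> z; rewrite m3 inE !mem_rev => zA /orP[z3|zB].
    have [//|E] := d13 z (sA z zA) z3.
    by move: (Av z zA); rewrite E eqxx.
  have [//|E] := d12 z (sA z zA) (sB' z zB).
  by move: (Av z zA); rewrite E eqxx.
have [|q4 [eq4 l4' m4']] := epath_cat eA' er4.
  move=> z; rewrite m4 inE !mem_rev => zA /orP[z3|zB].
    have [E|//] := d13 z (sA' z zA) z3.
    by move: (Au z zA); rewrite E eqxx.
  have [E|//] := d12 z (sA' z zA) (sB z zB).
  by move: (Au z zA); rewrite E eqxx.
(* The routes visit [x u y], [x v y], [x u v y] and [x v u y]. Each of the two pairs uses every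
   piece once, and the second pair crosses the third leg twice besides. *)
exists q1, q2, q3, q4; split=> //.
  have C z : z \in A \/ z \in A' \/ z \in B \/ z \in B' \/ z \in p3 ->
      z \in p1 ++ p2 ++ p3.
    rewrite !mem_cat.
    by move=> [/sA|[/sA'|[/sB|[/sB'|]]]] ->; rewrite ?orbT.
  move=> z zq; apply: C; move: zq.
  rewrite !mem_cat m1 m2 m3' m4' !inE m3 m4 !inE !mem_rev.
  by do ![case/orP]; tauto.
rewrite l1 l2 l3' l4' l3 l4 !path_length_rev; lia.
Qed.

(** * Degrees at the branch vertices of a theta *)

Lemma leg_neighbor (T : finType) (H : graph T) u v p : u != v ->
  xy_path H u v p -> exists a q, [/\ p = u :: a :: q, adj H u a, a != u
    & (a = v /\ q = [::]) \/ a \in interior p].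
Proof.
move=> uv /xy_path_epath[ep _]; have := ep.
case=> [[|a q] [E ea ua la]]; first by rewrite -la eqxx in uv.
exists a, q; have [h1 h2] := andP ea; have [h3 h4] := andP ua.
move: h3; rewrite inE eq_sym => /norP[au _]; split=> //.
have [av|av] := eqVneq a v; last first.
  by right; rewrite (mem_interior _ ep) E !inE eqxx orbT av au.
left; split=> //; case: q {E ea ua h2} la h4 => [//|b q] la /=.
by rewrite av -la /= mem_last.
Qed.

(** At most one of two distinct legs is a single edge. Any other first neighbor is interior to its
    leg, hence differs from [v] and from the interior vertices of the other leg. *)
Lemma leg_neighbors_neq (T : finType) (H : graph T) u v p q a b p' q' :
  xy_path H u v p -> xy_path H u v q ->
  p = u :: a :: p' -> q = u :: b :: q' -> p != q ->
  [disjoint interior p & interior q] ->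
  (a = v /\ p' = [::]) \/ a \in interior p ->
  (b = v /\ q' = [::]) \/ b \in interior q -> a != b.
Proof.
move=> /xy_path_epath[ep _] /xy_path_epath[eq _] pE qE pq dpq ha hb.
apply/eqP => ab.
case: ha => [[av p0]|ai]; case: hb => [[bv q0]|bi].
- by move: pq; rewrite pE qE p0 q0 ab eqxx.
- by move: bi; rewrite (mem_interior _ eq) -ab av eqxx !andbF.
- by move: ai; rewrite (mem_interior _ ep) ab bv eqxx !andbF.
- by move: (disjointFr dpq ai); rewrite ab bi.
Qed.

(** The legs give [u] three distinct neighbors in [Th], and a neighbor outside would be a fourth.
    This keeps links from attaching at branch vertices. *)
Lemma theta_end_degree (T : finType) (Th H : graph T) u v p1 p2 p3 w :
  u != v -> xy_path Th u v p1 -> xy_path Th u v p2 -> xy_path Th u v p3 ->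
  pairwise (fun p q => (p != q) && [disjoint interior p & interior q])
    [:: p1; p2; p3] ->
  eset Th \subset eset H -> subcubic H -> adj H u w -> w \in vset Th.
Proof.
move=> uv e1 e2 e3; rewrite /= !andbT.
move=> /andP[/andP[/andP[n12 d12] /andP[n13 d13]] /andP[n23 d23]].
move=> /adj_sub ThH cH uw; apply: contraT => wTh.
have [a1 [q1 [E1 ua1 _ h1]]] := leg_neighbor uv e1.
have [a2 [q2 [E2 ua2 _ h2]]] := leg_neighbor uv e2.
have [a3 [q3 [E3 ua3 _ h3]]] := leg_neighbor uv e3.
have a12 := leg_neighbors_neq e1 e2 E1 E2 n12 d12 h1 h2.
have a13 := leg_neighbors_neq e1 e3 E1 E3 n13 d13 h1 h3.
have a23 := leg_neighbors_neq e2 e3 E2 E3 n23 d23 h2 h3.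
have aw a : adj Th u a -> a != w.
  by move=> ua; apply: contraNneq wTh => <-; apply: (@adj_vset _ _ _ u); rewrite adj_sym.
have us : uniq [:: a1; a2; a3; w] by rewrite /= !inE !negb_or a12 a13 a23 !aw.
have := cH u (adj_vset uw); apply: contraTT => _; rewrite -ltnNge.
rewrite -[4]/(size [:: a1; a2; a3; w]) -(card_uniqP us).
apply: subset_leq_card; apply/subsetP => z; rewrite !inE.
by case/or4P=> /eqP->; rewrite // ThH.
Qed.

Lemma xy_path_rev (T : finType) (G : graph T) x y p :
  xy_path G x y p -> xy_path G y x (rev p).
Proof.
move=> h; have [/(epath_rev (@adj_sym _ G)) [q [E sq uq lq]] pV] := xy_path_epath h.
apply/and3P; rewrite E /= lq !eqxx; split=> //; apply/and4P; split=> //.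
by rewrite -E all_rev; apply/allP => z /pV.
Qed.

Lemma interior_rev (T : finType) (G : graph T) x y p :
  xy_path G x y p -> interior (rev p) = interior p.
Proof.
move=> /xy_path_epath[ep _]; apply/setP => z.
rewrite (mem_interior _ ep) (mem_interior _ (epath_rev (@adj_sym _ G) ep)).
by rewrite mem_rev; do 2!case: eqP; rewrite ?andbF ?andbT.
Qed.

Lemma theta_leg_common (T : finType) (G : graph T) u v p q z :
  xy_path G u v p -> xy_path G u v q -> [disjoint interior p & interior q] ->
  z \in p -> z \in q -> z = u \/ z = v.
Proof.
move=> /xy_path_epath[ep _] /xy_path_epath[eq _] dpq zp zq.
have [->|zu] := eqVneq z u; first by left.
have [->|zv] := eqVneq z v; first by right.
have zi : z \in interior p by rewrite (mem_interior _ ep) zp zu.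
by move: (disjointFr dpq zi); rewrite (mem_interior _ eq) zq zu zv.
Qed.

Lemma theta_necklace_residue (T : finType) (G H : graph T) k m N h :
  odd k -> h = 1 \/ h = 2 -> 2 < N -> k * (2 * k) <= N ->
  subgraph H G -> theta_necklace N h H ->
  exists c, is_cycle G c /\ size c = m %[mod k].
Proof.
move=> k_odd h12 N2 kN /andP[_ /adj_sub HG] [_ cH].
case=> Th [u [v [L1 [L2 [L3 [P [[dTh dP] thP AB iP consH]]]]]]].
have [xs [ys eP]] := AB_path_ends AB.
pose V i := vset (Th i).
have PG i : epath (adj G) (ys i) (xs i) (P i).
  by have [_ _ /(epath_sub HG)] := eP i.
have ThH i := consists_of_sub i consH.
have LV i z : z \in L1 i ++ L2 i ++ L3 i -> z \in V i.
  by have [[_ _ _ VE _] _] := thP i; rewrite /V VE inE.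
have ysL i : ys i \in L2 i by have [_ + _] := eP i; rewrite inE.
have xsL i : xs i \in L1 (ordS i) by have [+ _ _] := eP i; rewrite inE.
have ysV i : ys i \in V i by apply: LV; rewrite !mem_cat ysL orbT.
have xsV i : xs i \in V (ordS i) by apply: LV; rewrite !mem_cat xsL.
have yx i : ys i != xs i by apply: (ys_neq_xs N2 dTh ysV xsV).
have SV i : [disjoint V (ordS i) & V i] by apply/dTh/ordS_neq/ltnW.
have inner i w : w \in P i -> w != ys i -> w != xs i -> forall j, w \notin V j.
  move=> wP wy wx j; have wi : w \in interior (P i).
    by rewrite (mem_interior _ (PG i)) wP wy.
  by rewrite (disjointFr (iP i j) wi).
have ends i z w : z = u i \/ z = v i -> adj H z w -> w \in V i.
  have [[uv [e1 e2 e3] pw _ _] _] := thP i.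
  case=> ->; first exact: (theta_end_degree uv e1 e2 e3 pw (ThH i) cH).
  (* Reversing the legs exchanges the roles of [u] and [v]. *)
  have [e1' e2' e3'] := And3 (xy_path_rev e1) (xy_path_rev e2) (xy_path_rev e3).
  rewrite eq_sym in uv; apply: (theta_end_degree uv e1' e2' e3' _ (ThH i) cH).
  move: pw; rewrite /= !(interior_rev e1) !(interior_rev e2) !(interior_rev e3).
  by rewrite !(inj_eq (can_inj (@revK T))).
(* The first edge of a link leaves the bead, whereas all neighbors of a branch vertex stay inside
   it. *)
have ys_in i : ys i <> u i /\ ys i <> v i.
  have [_ _ /(epath_edge (yx i))[w [yw wP wy]]] := eP i.
  have wV : w \notin V i.
    have [->|wx] := eqVneq w (xs i); last exact: inner wP wy wx i.
    by rewrite (disjointFr (SV i)).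
  by split=> E; move: wV; rewrite (ends i (ys i) w) //; [left|right].
have xs_in i : xs i <> u (ordS i) /\ xs i <> v (ordS i).
  have [_ _ /(epath_rev (@adj_sym _ H)) eP'] := eP i.
  have [|w [xw + wx]] := epath_edge _ eP'; first by rewrite eq_sym.
  rewrite mem_rev => wP.
  have wV : w \notin V (ordS i).
    have [->|wy] := eqVneq w (ys i); last exact: inner wP wy wx _.
    by rewrite (disjointFl (SV i)).
  by split=> E; move: wV; rewrite (ends _ (xs i) w) //; [left|right].
have /fin_all_exists[s /fin_all_exists[s' /fin_all_exists[a /fin_all_exists[a' sP]]]] i :
    exists s s' a a', [/\ route G k V xs ys i s, route G k V xs ys i s',
      route G k V xs ys i a, route G k V xs ys i a' & s + s' + 2 * h = a + a'].
  have [[uv [e1 e2 e3] pw _ _] lh] := thP i.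
  move: pw; rewrite /= !andbT.
  move=> /andP[/andP[/andP[n12 d12] /andP[n13 d13]] /andP[n23 d23]].
  have ThG : subrel (adj (Th i)) (adj G) by move=> y z /(adj_sub (ThH i))/HG.
  have [[E1 _] [E2 _] [E3 _]] :=
    And3 (xy_path_epath e1) (xy_path_epath e2) (xy_path_epath e3).
  have xL : xs (ord_pred i) \in L1 i by have := xsL (ord_pred i); rewrite ord_predK.
  have [/eqP xu /eqP xv] := xs_in (ord_pred i); rewrite ord_predK in xu xv.
  have [/eqP yu /eqP yv] := ys_in i.
  have [q1 [q2 [q3 [q4 [[r1 r2 r3 r4] sub E]]]]] :=
    theta_routes (@adj_sym _ G) (epath_sub ThG E1) (epath_sub ThG E2)
      (epath_sub ThG E3) (fun z => theta_leg_common e1 e2 d12)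
      (fun z => theta_leg_common e1 e3 d13) (fun z => theta_leg_common e2 e3 d23)
      xL xu xv (ysL i) yu yv.
  exists (path_length q1), (path_length q2), (path_length q3), (path_length q4).
  split; last by rewrite -lh.
  - by exists q1; split=> // z zq; apply/LV/sub; rewrite !mem_cat zq.
  - by exists q2; split=> // z zq; apply/LV/sub; rewrite !mem_cat zq ?orbT.
  - by exists q3; split=> // z zq; apply/LV/sub; rewrite !mem_cat zq ?orbT.
  - by exists q4; split=> // z zq; apply/LV/sub; rewrite !mem_cat zq ?orbT.
have hk : coprime (2 * h) k.
  by case: h12 => ->; rewrite coprimeMl !coprime2n ?coprime1n k_odd.
have [|||d dP' dE] := @theta_residues N k (\sum_(i < N) path_length (P i)) m
  (route G k V xs ys) k_odd _ s s' a a' h hk _ _ kN.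
- by move=> i d d'; apply: route_mod.
- by move=> i; have [] := sP i.
- by move=> i; have [] := sP i.
have [c [cc sc]] := route_cycle N2 dTh dP PG ysV xsV iP dP'.
by exists c; rewrite sc.
Qed.

(** * Close paths and cycles *)

Section Zigzag.
Variables (T : finType) (e : rel T) (p c : seq T) (k d r : nat).
Variables (al be : nat -> T) (la : nat -> seq T).
Hypothesis e_sym : symmetric e.
Hypotheses (p_sorted : sorted e p) (p_uniq : uniq p).
Hypotheses (c_cycle : cycle e c) (c_uniq : uniq c).
Hypothesis pc : forall z, z \in p -> z \notin c.
Hypothesis la_path : forall j, j < r -> epath e (al j) (be j) (la j).
Hypothesis la_len : forall j, j < r -> path_length (la j) = d.
Hypothesis al_p : forall j, j < r -> al j \in p.
Hypothesis be_c : forall j, j < r -> be j \in c.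
Hypothesis la_p : forall j z, j < r -> z \in la j -> z \in p -> z = al j.
Hypothesis la_c : forall j z, j < r -> z \in la j -> z \in c -> z = be j.
Hypothesis la_disj : forall i j z, i < j < r -> z \in la i -> z \notin la j.
Hypothesis al_lt : forall i j, i < j < r -> index (al i) p < index (al j) p.
Hypothesis be_lt : forall i j, i < j < r -> index (be i) c < index (be j) c.
Hypothesis al_mod : forall i j, i < r -> j < r ->
  index (al i) p = index (al j) p %[mod k].
Hypothesis be_mod : forall i j, i < r -> j < r ->
  index (be i) c = index (be j) c %[mod k].

Let c_sorted : sorted e c.
Proof. by case: (c) c_cycle => //= x s; rewrite rcons_path => /andP[]. Qed.

Lemma mod_diff a b : a <= b -> a = b %[mod k] -> b - a = 0 %[mod k].
Proof.
by move=> ab E; apply/eqP; rewrite -(eqn_modDr a) subnK // add0n E.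
Qed.

(** Go back along link [j] to [p], follow [p] to the next foot, and return to [c] along link [j.+1].
    The links contribute [2 * d] and the stretch of [p] a positive multiple of [k]. The positions on
    [p] are recorded to keep different hops disjoint. *)
Lemma hop j : j.+1 < r -> exists Q, [/\ epath e (be j) (be j.+1) Q,
  2 < path_length Q, path_length Q = 2 * d %[mod k]
  & forall z, z \in Q ->
    [\/ z \in p /\ index (al j) p <= index z p <= index (al j.+1) p,
        z = be j \/ z = be j.+1
      | [/\ z \notin p, z \notin c & z \in la j \/ z \in la j.+1]]].
Proof.
move=> jr; have jr' : j < r := ltnW jr.
have jj : j < j.+1 < r by rewrite ltnSn.
have ab i : i < r -> al i != be i.
  by move=> ir; apply: contraTneq (be_c ir) => <-; apply/pc/al_p.
have [S [eS lS mS]] :=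
  epath_segment p_sorted p_uniq (al_p jr') (al_p jr) (ltnW (al_lt jj)).
have [|S1 [eS1 lS1 mS1]] := epath_cat (epath_rev e_sym (la_path jr')) eS.
  by move=> z; rewrite mem_rev => zl /mS[zp _]; apply: la_p zl zp.
have [|Q [eQ lQ mQ]] := epath_cat eS1 (la_path jr).
  move=> z; rewrite mS1 inE mem_rev => /orP[zl|/mS[zp _] zl].
    by rewrite (negbTE (la_disj jj zl)).
  exact: la_p zl zp.
have d0 : 0 < d.
  rewrite -(la_len jr'); have [m [-> _ _]] := epath_rconsE (ab j jr') (la_path jr').
  by rewrite /path_length /= size_rcons.
have sE : path_length Q = 2 * d + (index (al j.+1) p - index (al j) p).
  by rewrite lQ lS1 path_length_rev !la_len // lS; lia.
exists Q; split=> //.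
- by rewrite sE; have := al_lt jj; lia.
- rewrite sE -modnDmr mod_diff ?mod0n ?addn0 //; first exact/ltnW/al_lt.
  exact: al_mod.
- have la_case i z : i < r -> z \in la i ->
      [\/ z = al i, z = be i | z \notin p /\ z \notin c].
    move=> ir zl; have [/(la_p ir zl)->|zp] := boolP (z \in p).
      exact: Or31.
    have [/(la_c ir zl)->|zc] := boolP (z \in c); first exact: Or32.
    exact: Or33.
  have aa := al_lt jj.
  move=> z; rewrite mQ inE mS1 inE mem_rev => /orP[/orP[zl|/mS[zp zi]]|zl].
  + have [->|->|[zp zc]] := la_case _ _ jr' zl.
    * by apply: Or31; split; [exact: al_p | lia].
    * by apply: Or32; left.
    * by apply: Or33; split=> //; left.
  + exact: Or31.
  + have [->|->|[zp zc]] := la_case _ _ jr zl.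
    * by apply: Or31; split; [exact: al_p | lia].
    * by apply: Or32; right.
    * by apply: Or33; split=> //; right.
Qed.

(** Hops over the link pairs 0 and 1, 2 and 3, and so on are joined by stretches of [c], whose
    lengths are multiples of [k]. The last clause confines the walk to initial ranges of positions
    and links, so that the next extension is disjoint from it. *)
Lemma zigzag t : 2 * t + 1 < r ->
  exists W, [/\ epath e (be 0) (be (2 * t + 1)) W, 2 < path_length W,
    path_length W = t.+1 * (2 * d) %[mod k]
  & forall z, z \in W ->
    [\/ z \in p /\ index z p <= index (al (2 * t + 1)) p,
        z \in c /\ index (be 0) c <= index z c <= index (be (2 * t + 1)) c
      | [/\ z \notin p, z \notin c & exists2 j, j < 2 * t + 2 & z \in la j]]].
Proof.
elim: t => [|t IH]; first rewrite muln0 !add0n; move=> tr.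
  have [Q [eQ l2 lQ mQ]] := @hop 0 tr; exists Q; rewrite mul1n; split=> // z.
  have b01 : index (be 0) c < index (be 1) c by apply: be_lt.
  case/mQ=> [[zp /andP[_ zi]]|[]->|[zp zc zl]].
  - exact: Or31.
  - by apply: Or32; split; [apply: be_c | ]; lia.
  - by apply: Or32; split; [apply: be_c | ]; lia.
  - by apply: Or33; split=> //; case: zl; [exists 0|exists 1].
have tr0 : 2 * t + 1 < r by lia.
have tr1 : (2 * t + 1).+1 < r by lia.
have tr2 : (2 * t + 2).+1 < r by lia.
have [W [eW l2 lW mW]] := IH tr0.
have E1 : (2 * t + 1).+1 = 2 * t + 2 by lia.
have E2 : (2 * t + 2).+1 = 2 * t.+1 + 1 by lia.
have b01 : index (be (2 * t + 1)) c < index (be (2 * t + 2)) c.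
  by apply: be_lt; lia.
have b12 : index (be (2 * t + 2)) c < index (be (2 * t.+1 + 1)) c.
  by apply: be_lt; lia.
have b00 : index (be 0) c < index (be (2 * t + 1)) c by apply: be_lt; lia.
have a01 : index (al (2 * t + 1)) p < index (al (2 * t + 2)) p.
  by apply: al_lt; lia.
have a12 : index (al (2 * t + 2)) p < index (al (2 * t.+1 + 1)) p.
  by apply: al_lt; lia.
have r2 : 2 * t + 2 < r by lia.
(* Extend along [c] to the foot of link [2 * t + 2], then hop over the next link pair. *)
have [S [eS lS mS]] :=
  epath_segment c_sorted c_uniq (be_c tr0) (be_c r2) (ltnW b01).
have [Q [eQ _ lQ mQ]] := hop tr2; rewrite E2 in eQ mQ.
have pNc z : z \in c -> z \in p -> False by move=> zc /pc; rewrite zc.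
have [|W1 [eW1 lW1 mW1]] := epath_cat eW eS.
  move=> z /mW zW /mS[zc zi].
  case: zW => [[zp _]|[_ zi']|[_ zc' _]]; first by case: (pNc z).
    by apply: (index_inj z zc (be_c tr0)) => /=; lia.
  by rewrite zc in zc'.
have [|W2 [eW2 lW2 mW2]] := epath_cat eW1 eQ.
  move=> z; rewrite mW1 inE => zWS /mQ zQ.
  have be12 : z = be (2 * t.+1 + 1) ->
      z \in c /\ index z c = index (be (2 * t.+1 + 1)) c by move=> ->; rewrite be_c.
  case: zQ => [[zp zi]|[//|/be12[zc zi]]|[zp zc zl]].
  - case/orP: zWS => [/mW|/mS[/pNc/(_ zp)//]].
    case=> [[_ zi']|[/pNc/(_ zp)//]|[]]; first lia.
    by rewrite zp.
  - case/orP: zWS => [/mW|/mS[_ zi']]; last lia.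
    case=> [[/(pNc _ zc)//]|[_ zi']|[_]]; first lia.
    by rewrite zc.
  - case/orP: zWS => [/mW|/mS[]]; last by rewrite (negbTE zc).
    case=> [[]|[]|[_ _ [j jt zj]]]; rewrite ?(negbTE zp) ?(negbTE zc) //.
    have [i [jr zi]] : exists i, j < i < r /\ z \in la i.
      by case: zl => zl; [exists (2 * t + 2)|exists (2 * t.+1 + 1)]; split=> //; lia.
    by move: (la_disj jr zj); rewrite zi.
exists W2; split=> //.
- by rewrite lW2 lW1; lia.
- rewrite lW2 lW1 lS -modnDmr lQ modnDmr addnAC -modnDmr.
  rewrite mod_diff; [|exact: ltnW|exact: be_mod].
  by rewrite mod0n addn0 -modnDml lW modnDml -mulSnr.
- move=> z; rewrite mW2 inE mW1 inE => /orP[/orP[/mW|/mS]|/mQ].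
  + case=> [[zp zi]|[zc zi]|[zp zc [j jt zj]]].
    * by apply: Or31; split=> //; lia.
    * by apply: Or32; split=> //; lia.
    * by apply: Or33; split=> //; exists j => //; lia.
  + by case=> zc zi; apply: Or32; split=> //; lia.
  + case=> [[zp zi]|[]->|[zp zc zl]].
    * by apply: Or31; split=> //; lia.
    * by apply: Or32; split; [apply: be_c | ]; lia.
    * by apply: Or32; split; [apply: be_c | ]; lia.
    * apply: Or33; split=> //.
      by case: zl => zl; [exists (2 * t + 2)|exists (2 * t.+1 + 1)] => //; lia.
Qed.

(** Close up by the arc of [c] that wraps around from the last foot to the first; its length is
    [size c] modulo [k], because the feet on [c] agree modulo [k]. *)
Lemma zigzag_cycle t : 2 * t + 1 < r ->
  exists C, [/\ 2 < size C, uniq C, cycle e C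
              & size C = size c + t.+1 * (2 * d) %[mod k]].
Proof.
move=> tr; have [W [eW l2 lW mW]] := zigzag tr.
have r0 : 0 < r by lia.
have b0 : index (be 0) c < index (be (2 * t + 1)) c by apply: be_lt; lia.
have [q [eq lq mq]] := epath_complement c_cycle c_uniq (be_c r0) (be_c tr) b0.
have [||C [cC uC sC]] := epath_cycle _ eW eq.
- by apply: contraTneq b0 => ->; rewrite ltnn.
- move=> z /mW zW /mq[zc zi].
  case: zW => [[/pc]|[_ zi']|[_]]; rewrite ?zc //.
  have [E|E] : index z c = index (be 0) c \/ index z c = index (be (2 * t + 1)) c.
    by lia.
  + by left; apply: (index_inj z) E; rewrite ?be_c.
  + by right; apply: (index_inj z) E; rewrite ?be_c.
exists C; split=> //; first by rewrite sC; lia.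
rewrite sC addnC -modnDmr lW modnDmr; apply/eqP; rewrite eqn_modDr.
by rewrite -(eqn_modDr (index (be (2 * t + 1)) c)) lq eqn_modDl; apply/eqP/be_mod.
Qed.

End Zigzag.

(** * Selecting links of one type *)

Lemma index_rev (T : eqType) (p : seq T) z : uniq p -> z \in p ->
  index z (rev p) = size p - (index z p).+1.
Proof.
move=> up zp; have ip : index z p < size p by rewrite index_mem.
have E : nth z (rev p) (size p - (index z p).+1) = z.
  rewrite nth_rev; last by move: ip; lia.
  by rewrite -[RHS](nth_index z zp); congr nth; lia.
rewrite -{1}E index_uniq ?rev_uniq // size_rev; move: ip; lia.
Qed.

Lemma modn_subr k n a b : a <= n -> b <= n -> a = b %[mod k] ->
  n - a = n - b %[mod k].
Proof.
move=> an bn ab; apply/eqP; rewrite -(eqn_modDr a) subnK // -{1}(subnK bn).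
by rewrite eqn_modDl ab.
Qed.

(** The factor [2 * (k * k)] counts link types: length 1 or 2 and the residues of both feet. One
    type then has [2 * k * (2 * k)] links, enough for a monotone sequence of [2 * k]. *)
Lemma close_residue (T : finType) (G : graph T) k m N p c :
  odd k -> (2 * (k * k)) * (2 * k * (2 * k)) <= N -> is_path G p -> is_cycle G c ->
  k_close G N [set x in p] [set x in c] ->
  exists C, is_cycle G C /\ size C = m %[mod k].
Proof.
move=> k_odd kN /and4P[_ up _ sp] /and3P[_ uc cc] [dpc [P [dP PP]]].
have k0 : 0 < k by case: (k) k_odd.
have pc z : z \in p -> z \notin c.
  by move=> zp; have := disjointFr dpc (x := z); rewrite !inE => ->.
have [be [al eP]] := AB_path_ends (fun j => proj1 (PP j)).
have alp j : al j \in p by have [_ + _] := eP j; rewrite inE.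
have bec j : be j \in c by have [+ _ _] := eP j; rewrite inE.
have Pp j z : z \in P j -> z \in p -> z = al j.
  have [_ _ ej] := eP j => zP zp; apply/eqP; apply: contraT => za.
  have [[x [y [_ _ _ di]]] _] := PP j.
  have zb : z != be j by apply: contraTneq zp => ->; apply: contraL (bec j); apply: pc.
  have := disjointFr di (x := z); rewrite (mem_interior _ ej) zP za zb !inE zp.
  by move=> /(_ isT).
have Pc j z : z \in P j -> z \in c -> z = be j.
  have [_ _ ej] := eP j => zP zc; apply/eqP; apply: contraT => zb.
  have [[x [y [_ _ _ di]]] _] := PP j.
  have za : z != al j by apply: contraTneq zc => ->; apply: pc.
  have := disjointFr di (x := z); rewrite (mem_interior _ ej) zP za zb !inE zc orbT.
  by move=> /(_ isT).
have Pinj i j z : z \in P i -> z \in P j -> i = j.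
  move=> zi zj; apply/eqP; apply: contraT => /dP dij.
  by rewrite (disjointFr dij zi) in zj.
have alP j : al j \in P j by have [_ _ /epath_start] := eP j.
have beP j : be j \in P j by have [_ _ /epath_end] := eP j.
pose modk x : 'I_k := Ordinal (ltn_pmod x k0).
pose f j := (path_length (P j) == 1, (modk (index (al j) p), modk (index (be j) c))).
have kT : #|{: bool * ('I_k * 'I_k)}| * (2 * k * (2 * k)) <= #|[set: 'I_N]|.
  by rewrite cardsT !card_prod card_bool !card_ord.
have [|tau kJ] := pigeonhole f _ kT.
  by rewrite !card_prod card_bool !card_ord !muln_gt0 k0.
set J := [set j in _ | _] in kJ.
have fJ i : i \in J -> f i = tau by rewrite !inE => /eqP.
pose d := if tau.1 then 1 else 2.
have dJ i : i \in J -> path_length (P i) = d.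
  move=> /fJ/(congr1 fst) /=; rewrite /d => <-; case: eqP => // l1.
  have [_ l2] := PP i; have [_ _ ej] := eP i.
  (* Length 0 is impossible because [p] and [c] are disjoint, so a length other than 1 is 2. *)
  have ab : al i != be i by apply: contraTneq (bec i) => <-; apply: pc.
  have [q [E _ _]] := epath_rconsE ab ej.
  have l0 : 0 < path_length (P i) by rewrite E /path_length /= size_rcons.
  by move: l0 l1 l2; clear; lia.
have aJ : {in J &, forall i j, index (al i) p = index (al j) p %[mod k]}.
  move=> i j iJ jJ; have := fJ i iJ; rewrite -(fJ j jJ).
  by move=> /(congr1 (fun x => val x.2.1)).
have bJ : {in J &, forall i j, index (be i) c = index (be j) c %[mod k]}.
  move=> i j iJ jJ; have := fJ i iJ; rewrite -(fJ j jJ).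
  by move=> /(congr1 (fun x => val x.2.2)).
have dk : coprime (2 * d) k.
  by rewrite coprimeMl coprime2n k_odd /d; case: (tau.1); rewrite ?coprime1n ?coprime2n.
(* The extra [2 * d] accounts for the [t.+1] hops made by [zigzag_cycle]. *)
have [t tk tE] := linear_residue (size c + 2 * d) m k0 dk.
(* [p'] will be [p] or its reversal, according to the direction of the monotone sequence. *)
have key p' s : sorted (adj G) p' -> uniq p' -> p' =i p ->
    {in J &, forall i j, index (al i) p' = index (al j) p' %[mod k]} ->
    size s = 2 * k -> {subset s <= J} ->
    sorted (relpre (fun j => index (al j) p') ltn) s ->
    sorted (relpre (fun j => index (be j) c) ltn) s ->
    exists C, is_cycle G C /\ size C = m %[mod k].
  move=> sp' up' pp' aJ' ss sJ sa sb.
  have [j0 _] : exists j0, j0 \in s.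
    case: (s) ss => [E|j s' _]; last by exists j; rewrite mem_head.
    by move: (k0) E; clear; case: k.
  pose g i := nth j0 s i.
  have gJ i : i < 2 * k -> g i \in J by rewrite -ss => ir; apply/sJ/mem_nth.
  have lt_trans (h : 'I_N -> nat) : transitive (relpre h ltn).
    by move=> x y z /=; apply: ltn_trans.
  have ga i j : i < j < 2 * k -> index (al (g i)) p' < index (al (g j)) p'.
    move=> /andP[ij jr]; apply: (sorted_ltn_nth (lt_trans _) j0 sa) => //.
      by rewrite inE ss; apply: ltn_trans ij jr.
    by rewrite inE ss.
  have gb i j : i < j < 2 * k -> index (be (g i)) c < index (be (g j)) c.
    move=> /andP[ij jr]; apply: (sorted_ltn_nth (lt_trans _) j0 sb) => //.
      by rewrite inE ss; apply: ltn_trans ij jr.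
    by rewrite inE ss.
  have [| | | | | | | | | | | | |C [C2 uC cC sC]] := @zigzag_cycle T (adj G) p' c k d
    (2 * k) (al \o g) (be \o g) (P \o g) (@adj_sym _ G) sp' up' cc uc
    _ _ _ _ _ _ _ _ _ _ _ _ t.
  - by move=> z; rewrite pp'; apply: pc.
  - by move=> j _ /=; have [] := eP (g j).
  - by move=> j /gJ/dJ.
  - by move=> j _ /=; rewrite pp'.
  - by move=> j _ /=.
  - by move=> j z _ /= zP; rewrite pp'; apply: Pp.
  - by move=> j z _ /=; apply: Pc.
  - move=> i j z ij /= zi; apply/negP => /(Pinj _ _ _ zi) E.
    by have := ga i j ij; rewrite E ltnn.
  - by move=> i j; apply: ga.
  - by move=> i j; apply: gb.
  - by move=> i j /gJ iJ /gJ jJ; apply: aJ'.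
  - by move=> i j /gJ iJ /gJ jJ; apply: bJ.
  - by move: tk; clear; lia.
  by exists C; split; [apply/and3P | rewrite sC mulSn addnA].
have ia : {in J &, injective (fun j => index (al j) p)}.
  move=> i j _ _ E; apply: (Pinj i j (al i)) => //.
  by rewrite (index_inj (al i) (alp i) (alp j) E).
have ib : {in J &, injective (fun j => index (be j) c)}.
  move=> i j _ _ E; apply: (Pinj i j (be i)) => //.
  by rewrite (index_inj (be i) (bec i) (bec j) E).
have [s [ss sJ sa [sb|sb]]] := monotone_sequence ia ib kJ; first exact: key sa sb.
have ip j : index (al j) p < size p by rewrite index_mem.
(* Reversing [s] makes the feet on [c] increase; reversing [p] as well keeps the feet on the path
   increasing. *)
apply: (key (rev p) (rev s)).
- by rewrite rev_sorted (eq_sorted (e' := adj G)) // => x y; apply: adj_sym.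
- by rewrite rev_uniq.
- by move=> z; rewrite mem_rev.
- move=> i j iJ jJ; rewrite !index_rev //.
  apply: modn_subr (ip i) (ip j) _; apply/eqP.
  rewrite -(addn1 (index (al i) p)) -(addn1 (index (al j) p)) eqn_modDr.
  exact/eqP/aJ.
- by rewrite size_rev.
- by move=> i; rewrite mem_rev; apply: sJ.
- rewrite rev_sorted; apply: sub_sorted sa => i j /=; rewrite !index_rev //.
  by move=> aij; apply: ltn_sub2l => //; apply: leq_ltn_trans aij (ip j).
- by rewrite rev_sorted.
Qed.

Theorem theorem2p9 (T : finType) (G : graph T) (k m : nat) :
  odd k -> k_good (162 * k ^ 8) G ->
  exists c : seq T, is_cycle G c /\ size c = m %[mod k].
Proof.
move=> k_odd; have k0 : 0 < k by case: (k) k_odd.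
have k_pow j : j <= 8 -> k ^ j <= k ^ 8 by apply: leq_pexp2l.
(* The three cases need at most [2 * k ^ 2], [2 * k] and [8 * k ^ 4] beads or links, with more than
   2 beads in the necklace cases. *)
have [k1 k2 k4] : [/\ k <= k ^ 8, k * k <= k ^ 8 & k ^ 4 <= k ^ 8].
  by split; [apply: (k_pow 1) | apply: (k_pow 2) | apply: (k_pow 4)].
case=> [[H [h [HG h12 nH]]]|[H [HG nH]]|[p [c [pP cC pc]]]].
- by apply: theta_necklace_residue k_odd h12 _ _ HG nH; lia.
- by apply: wiggly_necklace_residue k_odd _ _ HG nH; lia.
- apply: close_residue k_odd _ pP cC pc.
  by move: k4; rewrite (expnD k 2 2) -mulnn; nia.
Qed.
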